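(* Let $L$ be a vector space over $\mathbb{R}$, let $M$ be a vector subspace of $L$, and let $\varphi : L \to \mathbb{R}$ be a sub-additive convex function. If $g : M \to \mathbb{R}$ is a linear function such that $g(x) \leq \varphi(x)$ for all $x \in M$, then there exists a linear function $f : L \to \mathbb{R}$ such that (i) $f$ extends $g$ to $L$, i.e. $f|_{M} = g$; and (ii) $f$ is dominated by $\varphi$, i.e. $f(x) \leq \varphi(x)$ for all $x \in L$.
   Context: Let $L$ be a real vector space with zero vector $\theta$. A function $\varphi : L \to \mathbb{R}$ is convex if $\varphi(\lambda x + (1-\lambda) y) \leq \lambda \varphi(x) + (1-\lambda)\varphi(y)$ for all $x, y \in L$ and all $\lambda \in \mathbb{R}$ with $0 < \lambda < 1$. It is sub-additive if $\varphi(x+y) \leq \varphi(x) + \varphi(y)$ for all $x, y \in L$ and, in addition, $\varphi(\theta) = 0$ (this condition is part of the definition). It is a sub-additive convex function if it is both sub-additive and convex in these senses. *)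

(* Defs.v *)
From HB Require Import structures.
From mathcomp Require Import all_boot all_order all_algebra.
From mathcomp Require Import interval_inference.
From mathcomp Require Import boolp classical_sets reals convex.

Set Implicit Arguments.
Unset Strict Implicit.
Unset Printing Implicit Defensive.

Import Order.TTheory GRing.Theory Num.Theory.

Local Open Scope classical_set_scope.
Local Open Scope ring_scope.

(* The value at the zero vector is part of the definition. *)
Definition sub_additive (R : realType) (L : lmodType R) (phi : L -> R) : Prop :=
  (forall x y : L, phi (x + y) <= phi x + phi y) /\ phi 0 = 0.

Definition sub_additive_convex (R : realType) (L : lmodType R)
    (phi : L -> R) : Prop :=
  sub_additive phi /\ convex_function [set: convex_lmodType L] phi.

(* [convex_function] lets the weight range over the closed unit interval;
   the weights 0 and 1 impose nothing. *)
Lemma convex_functionTP (R : realType) (L : lmodType R) (phi : L -> R) :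
  convex_function [set: convex_lmodType L] phi <->
  forall (x y : L) (l : R), 0 < l -> l < 1 ->
    phi (l *: x + (1 - l) *: y) <= l * phi x + (1 - l) * phi y.
Proof.
split=> [cphi x y l l0 l1|cphi t x y _ _].
  by have := cphi (Itv01 (ltW l0) (ltW l1)) x y; apply; rewrite in_setT.
have [->|t0] := eqVneq t 0%:i01; first by rewrite !conv0.
have [->|t1] := eqVneq t 1%:i01; first by rewrite !conv1.
apply: (cphi x y t%:num); first by rewrite lt_neqAle eq_sym t0 ge0.
by rewrite lt_neqAle t1 le1.
Qed.

(* In the theorem a vector subspace is given by its membership predicate [S]
   together with its carrier [M : subLmodType S], whose inclusion
   [\val : M -> L] is linear with image [S]. The alias below shows that every
   subspace has such a carrier. *)
Definition subspace_type (R : realType) (L : lmodType R)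
    (S : submodClosed L) : Type := {x : L | x \in S}.

Section subspace_type_instances.
Context (R : realType) (L : lmodType R) (S : submodClosed L).

HB.instance Definition _ := SubChoice.on (subspace_type S).
HB.instance Definition _ :=
  [SubChoice_isSubLmodule of subspace_type S by <:].

End subspace_type_instances.

(* Main.v *)
Require Import Defs.
From mathcomp Require Import all_boot all_order all_algebra.
From mathcomp Require Import reals.
From HB Require Import structures.
From mathcomp Require Import lra ring.
From mathcomp Require Import boolp classical_sets convex.

Import Order.TTheory GRing.Theory Num.Theory.
Local Open Scope ring_scope.

(** The theorem is the Hahn-Banach theorem, and convexity of [phi] carries it.

    Partial linear functionals are handled through their graphs, as sets of
    pairs in [L * R] closed under linear combinations.  A linear set of pairs
    lying below [phi] is automatically single-valued
    ([dominated_functional]), because a nonzero vertical vector [(0, d)] could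
    be scaled above [phi 0]; hence linearity and domination are all that has
    to be preserved.  Both pass to unions of chains, so Zorn's lemma gives a
    maximal such set containing the graph of [g] ([exists_maximal_dominated]).

    A maximal set is defined everywhere.  Given any vector [v], a value [c] at
    [v] is admissible when [r + t * c <= phi (x + t *: v)] for all [(x, r)] in
    the set and all [t].  Dividing by [t], this asks that [c] separate the
    slopes [(r - phi (x - a *: v)) / a] from the slopes
    [(phi (y + b *: v) - s) / b], with [a, b > 0]; convexity says precisely
    that the former are below the latter ([slope_le]), so the supremum of the
    former is such a [c] ([exists_admissible]).  By maximality [(v, c)] was
    already in the set, which is therefore the graph of the desired [f]. *)

Section dominated_graphs.
Local Open Scope classical_set_scope.
Context {R : realType} {L : lmodType R}.
Implicit Types (A B : set (L * R)) (x y v : L) (r s t c : R).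

Definition linear_graph A : Prop :=
  forall t x r y s, A (x, r) -> A (y, s) -> A (t *: x + y, t * r + s).

Definition dominated_graph (phi : L -> R) A : Prop :=
  forall x r, A (x, r) -> r <= phi x.

Lemma linear_graph0 {A} : linear_graph A -> A !=set0 -> A (0, 0).
Proof.
move=> linA [[x r] Axr].
by have := linA (-1) _ _ _ _ Axr Axr; rewrite scaleN1r mulN1r !addNr.
Qed.

(** The difference [(0, r - s)] of two pairs over [x] can be scaled so that its
    second entry is [phi 0 + 1], unless [r = s]. *)
Lemma dominated_functional {phi A} : linear_graph A -> dominated_graph phi A ->
  forall x r s, A (x, r) -> A (x, s) -> r = s.
Proof.
move=> linA domA x r s Ar As; apply/eqP; rewrite -subr_eq0; apply/negPn/negP.
move=> rs0; have A00 : A (0, 0) by apply: linear_graph0 => //; exists (x, r).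
have Ad : A (0, r - s).
  by have := linA (-1) _ _ _ _ As Ar; rewrite scaleN1r mulN1r addNr addrC.
have /domA := linA ((phi 0 + 1) / (r - s)) _ _ _ _ Ad A00.
by rewrite scaler0 !addr0 divfK// gerDl ler10.
Qed.

Definition extend_graph A v c : set (L * R) :=
  [set p | exists x r t, A (x, r) /\ p = (x + t *: v, r + t * c)].

Lemma linear_extend_graph {A v c} :
  linear_graph A -> linear_graph (extend_graph A v c).
Proof.
move=> linA t _ _ _ _ [x [r [a [Ax [-> ->]]]]] [y [s [b [Ay [-> ->]]]]].
exists (t *: x + y), (t * r + s), (t * a + b); split; first exact: linA.
by rewrite scalerDr scalerDl scalerA addrACA; congr pair; ring.
Qed.

Lemma sub_extend_graph {A v c} : A `<=` extend_graph A v c.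
Proof.
by move=> [x r] Axr; exists x, r, 0; rewrite scale0r mul0r !addr0.
Qed.

Section extension.
Context {phi : L -> R}.
Hypothesis cphi : convex_function [set: convex_lmodType L] phi.

(** The point [(b *: x + a *: y) / (a + b)] is the convex combination of
    [x - a *: v] and [y + b *: v] in which [v] cancels: the functional is below
    [phi] there, and convexity bounds [phi] by its values at the two ends. *)
Lemma slope_le {A} v : linear_graph A -> dominated_graph phi A ->
  forall x r y s a b, A (x, r) -> A (y, s) -> 0 < a -> 0 < b ->
  (r - phi (x - a *: v)) / a <= (phi (y + b *: v) - s) / b.
Proof.
move=> linA domA x r y s a b Ax Ay a0 b0.
have A00 : A (0, 0) by apply: linear_graph0 => //; exists (x, r).
have ab0 : 0 < a + b by rewrite addr_gt0.
have ab1 : a + b != 0 by rewrite gt_eqF.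
pose l := b / (a + b).
have l0 : 0 < l by rewrite divr_gt0.
have l1E : 1 - l = a / (a + b) by rewrite /l; field.
have l1 : l < 1 by rewrite -subr_gt0 l1E divr_gt0.
have Al : A (l *: x + (1 - l) *: y, l * r + (1 - l) * s).
  apply: (linA) => //; have := linA (1 - l) _ _ _ _ Ay A00.
  by rewrite !addr0.
have := (convex_functionTP phi).1 cphi (x - a *: v) (y + b *: v) l l0 l1.
have -> : l *: (x - a *: v) + (1 - l) *: (y + b *: v) =
          l *: x + (1 - l) *: y.
  rewrite !scalerDr scalerN !scalerA addrACA -scaleNr -scalerDl.
  suff -> : - (l * a) + (1 - l) * b = 0 by rewrite scale0r addr0.
  by rewrite l1E /l; field.
move/(le_trans (domA _ _ Al)).
set p := phi _; set q := phi _; rewrite l1E /l => H.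
rewrite ler_pdivrMr// mulrAC ler_pdivlMr//.
have {H} := ler_wpM2l (ltW ab0) H.
have -> : (a + b) * (b / (a + b) * r + a / (a + b) * s) = b * r + a * s by field.
have -> : (a + b) * (b / (a + b) * p + a / (a + b) * q) = b * p + a * q by field.
by move=> H; lra.
Qed.

Lemma exists_admissible {A} v : linear_graph A -> dominated_graph phi A ->
  A !=set0 -> exists c, dominated_graph phi (extend_graph A v c).
Proof.
move=> linA domA A0; have A00 := linear_graph0 linA A0.
pose E := [set e | exists x r (a : R),
  [/\ A (x, r), 0 < a & e = (r - phi (x - a *: v)) / a]].
have E0 : E !=set0 by exists ((0 - phi (0 - 1 *: v)) / 1), 0, 0, 1.
have ubE y s b : A (y, s) -> 0 < b -> ubound E ((phi (y + b *: v) - s) / b).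
  by move=> Ay b0 _ [x [r [a [Ax a0 ->]]]]; exact: (slope_le v linA domA).
have hubE : has_ubound E by exists ((phi (0 + 1 *: v) - 0) / 1); exact: ubE.
exists (sup E) => _ _ [x [r [t [Ax [-> ->]]]]].
have [t0|t0|->] := ltgtP t 0; last by rewrite scale0r mul0r !addr0; exact: domA.
- have a0 : 0 < - t by rewrite oppr_gt0.
  have : E ((r - phi (x - (- t) *: v)) / (- t)) by exists x, r, (- t).
  move=> /(ub_le_sup hubE); rewrite scaleNr opprK ler_pdivrMr//.
  by move=> H; lra.
- have := ge_sup E0 (ubE _ _ _ Ax t0); rewrite ler_pdivlMr// => H.
  by lra.
Qed.

End extension.

Lemma exists_maximal_dominated {phi} {G : set (L * R)} : G !=set0 ->
  linear_graph G -> dominated_graph phi G ->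
  exists A, [/\ G `<=` A, linear_graph A, dominated_graph phi A &
    forall B, A `<=` B -> linear_graph B -> dominated_graph phi B -> B `<=` A].
Proof.
move=> G0 linG domG.
(* The empty chain has union [set0], so [set0] must be admitted; it is not
   maximal because [G] is larger. *)
pose P := [set A | [/\ linear_graph A, dominated_graph phi A &
  A !=set0 -> G `<=` A]].
have [F FP Ftot|A [[linA domA GA] maxA]] := @Zorn_bigcup _ P.
  split.
  - move=> t x r y s [X FX Xx] [Y FY Yy].
    have [XY|YX] := Ftot _ _ FX FY.
      by exists Y => //; have [+ _ _] := FP _ FY; apply => //; exact: XY.
    by exists X => //; have [+ _ _] := FP _ FX; apply => //; exact: YX.
  - by move=> x r [X FX Xx]; have [_ + _] := FP _ FX; apply.
  - move=> [p [X FX Xp]]; have [_ _ GX] := FP _ FX.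
    by apply: subset_trans (bigcup_sup FX); apply: GX; exists p.
have A0 : A !=set0.
  apply/set0P/eqP => A0; apply: (maxA G); last first.
    by split=> // _; exact: subset_refl.
  by rewrite A0; split=> [? []|G0s]; case: G0 => p /G0s.
exists A; split => //; first exact: GA.
move=> B AB linB domB; apply: contrapT => BA.
apply: (maxA B); first by split.
by split=> // _; apply: subset_trans AB; exact: GA.
Qed.

(** Chosen values are additive and homogeneous because each vector has only
    one available value. *)
Lemma linear_graph_scalar {phi A} : linear_graph A -> dominated_graph phi A ->
  (forall v, exists c, A (v, c)) ->
  exists f : {scalar L}, forall x, A (x, f x).
Proof.
move=> linA domA /choice[f Af].
have linf : scalar f.
  move=> t x y; apply: (dominated_functional linA domA (t *: x + y)) => //.
  exact: linA.
pose F : {scalar L} := HB.pack f (GRing.isLinear.Build _ _ _ _ f linf).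
by exists F.
Qed.

(** Extending a maximal graph by an admissible value at [v] yields nothing
    new, so [v] already had a value: a maximal graph is total. *)
Lemma hahn_banach_convex {phi G} :
  convex_function [set: convex_lmodType L] phi ->
  G !=set0 -> linear_graph G -> dominated_graph phi G ->
  exists f : {scalar L}, (forall x r, G (x, r) -> f x = r) /\
    (forall x, f x <= phi x).
Proof.
move=> cphi G0 linG domG.
have [A [GA linA domA maxA]] := exists_maximal_dominated G0 linG domG.
have A0 : A !=set0 by case: G0 => p /GA Ap; exists p.
have totA v : exists c, A (v, c).
  have [c domc] := exists_admissible cphi v linA domA A0.
  exists c; apply: (maxA _ sub_extend_graph (linear_extend_graph linA) domc).
  exists 0, 0, 1; rewrite scale1r mul1r !add0r.
  by split=> //; exact: linear_graph0.
have [f Af] := linear_graph_scalar linA domA totA.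
exists f; split=> [x r /GA Ax|x]; last exact: domA.
exact: (dominated_functional linA domA).
Qed.

End dominated_graphs.

Theorem theorem2p3 (R : realType) (L : lmodType R)
    (S : {pred L}) (M : subLmodType S) (phi : L -> R) (g : {scalar M}) :
  sub_additive_convex phi ->
  (forall x : M, g x <= phi (\val x)) ->
  exists f : {scalar L},
    (forall x : M, f (\val x) = g x) /\ (forall x : L, f x <= phi x).
Proof.
move=> [_ cphi] gphi.
pose G : set (L * R) := range (fun x : M => (\val x, g x)).
have G0 : (G !=set0)%classic by exists (\val (0 : M), g 0), 0.
have linG : linear_graph G.
  move=> t _ _ _ _ [x _ [<- <-]] [y _ [<- <-]].
  by exists (t *: x + y) => //; rewrite !linearP.
have domG : dominated_graph phi G by move=> _ _ [x _ [<- <-]].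
have [f [fG fphi]] := hahn_banach_convex cphi G0 linG domG.
by exists f; split=> // x; apply: fG; exists x.
Qed.
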